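(* Let $V=\bigoplus_{i\ge0}V^i$ be a vertex operator algebra over $\mathbb{C}$ of CFT-type with a non-degenerate invariant bilinear form $(\cdot|\cdot)$ normalized so that $(\mathbf 1|\mathbf 1)=-1$. Let $c$ be the central charge of $V$ and let $d=\dim V^1$, with $d>0$. Assume that $c\neq0$ and that the second Casimir element satisfies $\kappa_2\in V_\omega^2$. Then for all $a_1,a_2,a_3\in V^1$, $$\mathrm{Tr}_{V^1}\, a_{1(0)}a_{2(0)}a_{3(0)}=\left(\frac{d}{c}-1\right)(a_1|a_{2(0)}a_3).$$
   Context: A vertex operator algebra (VOA) $V=\bigoplus_{i=0}^\infty V^i$ over $\mathbb{C}$ has vertex operators $Y(v,z)=\sum_{i\in\mathbb{Z}}v_{(i)}z^{-i-1}$, vacuum vector $\mathbf 1\in V^0$ and conformal vector $\omega\in V^2$; $L(m)=\omega_{(m+1)}$ generate a representation of the Virasoro algebra with central charge $c\in\mathbb{C}$. $V$ is of CFT-type if $V^0=\mathbb{C}\mathbf 1$. Invariant bilinear forms are in the sense of Frenkel--Huang--Lepowsky; with the normalization $(\mathbf 1|\mathbf 1)=-1$ one has $(a|b)\mathbf 1=a_{(1)}b$ for $a,b\in V^1$. The space $V^1$ is a Lie algebra with bracket $[a,b]=a_{(0)}b$, and $a_{(0)}$ ($a\in V^1$) acts on $V^1$. $V_\omega$ is the subVOA generated by $\omega$, and $V_\omega^i=V_\omega\cap V^i$. For a basis $x^1,\dots,x^d$ of $V^1$ with dual basis $x_1,\dots,x_d$ with respect to $(\cdot|\cdot)$, the $i$-th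 Casimir element is $\kappa_i=\sum_{j=1}^d x^j_{(1-i)}x_j\in V^i$ (independent of the choice of basis). *)

(* Defs.v *)
From HB Require Import structures.
From mathcomp Require Import all_boot all_order all_algebra.

Set Implicit Arguments.
Unset Strict Implicit.
Unset Printing Implicit Defensive.

Import Order.TTheory GRing.Theory Num.Theory.
Local Open Scope ring_scope.

(* m (m - 1) ... (m - i + 1) / i!, for an arbitrary integer m. *)
Definition binz (K : numFieldType) (m : int) (i : nat) : K :=
  (\prod_(j < i) (m - j%:Z))%:~R / i`!%:R.

(* [nprod a n b] is a_(n) b.  The homogeneous subspace V^i is the image of
   [inj i]; the maps [inj] and [proj] present V as the direct sum of the V^i,
   and V^i is finite-dimensional because [piece i] is a vectType.
   L(m) is omega_(m+1), so that L(-1) = omega_(0) and L(0) = omega_(1). *)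
Record voa (K : numFieldType) := VOA {
  space :> lmodType K;
  piece : nat -> vectType K;
  inj : forall i : nat, {linear piece i -> space};
  proj : forall i : nat, {linear space -> piece i};
  projK : forall i (u : piece i), proj i (inj i u) = u;
  proj_neq : forall i j (u : piece j), i != j -> proj i (inj j u) = 0;
  proj_sum : forall v : space,
    exists N : nat, v = \sum_(i < N) inj i (proj i v);
  nprod : space -> int -> space -> space;
  nprod_linearr : forall a n, linear (nprod a n);
  nprod_linearl : forall n b, linear (fun a => nprod a n b);
  vac : space;
  omega : space;
  ccharge : K;
  vac_piece : exists u : piece 0, vac = inj 0 u;
  omega_piece : exists u : piece 2, omega = inj 2 u;
  truncation : forall a b, exists N : int,
    forall n : int, N <= n -> nprod a n b = 0;
  vacuum : forall (n : int) b, nprod vac n b = if n == -1 then b else 0;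
  creation : forall a, nprod a (-1) vac = a;
  creation_ge0 : forall a (n : int), 0 <= n -> nprod a n vac = 0;
  (* The Jacobi identity in components.  By truncation only finitely many
     terms of the two sums over i >= 0 are nonzero, so the sums are equal iff
     their partial sums eventually agree. *)
  borcherds : forall a b u (l m n : int), exists N0 : nat,
    forall N : nat, (N0 <= N)%N ->
    \sum_(i < N) binz K m i *: nprod (nprod a (l + i%:Z) b) (m + n - i%:Z) u =
    \sum_(i < N) ((-1) ^+ i * binz K l i) *:
      (nprod a (l + m - i%:Z) (nprod b (n + i%:Z) u) -
       (-1) ^ l *: nprod b (l + n - i%:Z) (nprod a (m + i%:Z) u));
  virasoro : forall (m n : int) v,
    nprod omega (m + 1) (nprod omega (n + 1) v) -
    nprod omega (n + 1) (nprod omega (m + 1) v) =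
    (m - n)%:~R *: nprod omega (m + n + 1) v +
    (if m + n == 0 then (m ^+ 3 - m)%:~R / 12%:R * ccharge else 0) *: v;
  L0_grading : forall i (u : piece i),
    nprod omega 1 (inj i u) = i%:R *: inj i u;
  translation : forall a (n : int) b,
    nprod (nprod omega 0 a) n b = (- n)%:~R *: nprod a (n - 1) b
}.

Arguments inj {K _} i.
Arguments proj {K _} i.
Arguments vac {K _}.
Arguments omega {K _}.

Section Notions.
Variables (K : numFieldType) (V : voa K).
Implicit Types (U : V -> Prop) (B : V -> V -> K).

Definition homogeneous (i : nat) (v : V) : Prop :=
  exists u : piece V i, v = inj i u.

Definition cft_type : Prop :=
  forall v : V, homogeneous 0 v <-> exists k : K, v = k *: vac.

Definition Lop (m : int) (v : V) : V := nprod omega (m + 1) v.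

(* For a in V^k this is the coefficient of z^(-n-1) in
     (Y(a, z) u | v) = (u | Y(e^(z L(1)) (- z^(-2))^(L(0)) a, z^(-1)) v);
   the exponential series stops at i = k because L(1)^i a is in V^(k-i). *)
Definition invariant B : Prop :=
  forall (k : nat) (a : V) (n : int) (u v : V), homogeneous k a ->
    B (nprod a n u) v =
    (-1) ^+ k * \sum_(i < k.+1) (i`!%:R)^-1 *
      B u (nprod (iter i (Lop 1) a) (2 * k%:Z - n - i%:Z - 2) v).

Definition invariant_bilinear_form B : Prop :=
  [/\ forall u, scalar (B u), forall v, scalar (B^~ v) & invariant B].

Definition nondegenerate_form B : Prop :=
  (forall u, (forall v, B u v = 0) -> u = 0) /\
  (forall v, (forall u, B u v = 0) -> v = 0).

Definition subVOA U : Prop :=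
  [/\ U vac,
      forall (k : K) u v, U u -> U v -> U (k *: u + v)
    & forall u (n : int) v, U u -> U v -> U (nprod u n v)].

Definition Vomega (v : V) : Prop :=
  forall U, subVOA U -> U omega -> U v.

Definition Vomega_piece (i : nat) (v : V) : Prop :=
  Vomega v /\ homogeneous i v.

Definition V1 := piece V 1.
Definition dimV1 : nat := \dim {: V1}.

Definition dual_bases B (x y : dimV1.-tuple V1) : Prop :=
  basis_of {: V1} x /\
  forall i j, B (inj 1 (tnth x i)) (inj 1 (tnth y j)) = (i == j)%:R.

Definition casimir (x y : dimV1.-tuple V1) (i : nat) : V :=
  \sum_(j < dimV1) nprod (inj 1 (tnth x j)) (1 - i%:Z) (inj 1 (tnth y j)).

(* a_(0) b for a, b in V^1, as an element of V^1; the projection loses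
   nothing, see [inj_bracket]. *)
Definition bracket (a b : V1) : V1 := proj 1 (nprod (inj 1 a) 0 (inj 1 b)).

Lemma bracket_linear a : linear (bracket a).
Proof.
by move=> k u v; rewrite /bracket linearP nprod_linearr linearP.
Qed.

HB.instance Definition _ a := GRing.isLinear.Build K V1 V1 *:%R (bracket a)
  (bracket_linear a).

Lemma L0_homogeneous (i : nat) (v : V) :
  nprod omega 1 v = i%:R *: v -> homogeneous i v.
Proof.
move=> L0v; have [N vE] := proj_sum v; exists (proj i v).
have nprodD n (F : 'I_n -> V) :
    nprod omega 1 (\sum_j F j) = \sum_j nprod omega 1 (F j).
  have np0 : nprod omega 1 (0 : V) = 0.
    have := nprod_linearr (omega : V) 1 (-1) 0 0.
    by rewrite scaler0 addr0 scaleN1r addNr.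
  elim: n F => [|n IHn] F; first by rewrite !big_ord0.
  rewrite !big_ord_recl -IHn.
  have := nprod_linearr (omega : V) 1 1 (F ord0) (\sum_j F (lift ord0 j)).
  by rewrite !scale1r.
have projE (j : 'I_N) : nat_of_ord j != i -> proj j v = 0.
  move=> ji; have /(congr1 (proj j)) := L0v.
  rewrite {1}vE nprodD linear_sum linearZ /= (bigD1 j) //= big1 ?addr0.
    rewrite L0_grading linearZ /= projK => /eqP; rewrite -subr_eq0 -scalerBl.
    by rewrite scaler_eq0 subr_eq0 eqr_nat (negPf ji) => /eqP.
  move=> k kj; rewrite L0_grading linearZ /= proj_neq ?scaler0 //.
  by rewrite eq_sym.
case: (ltnP i N) => [iN|Ni].
  rewrite {1}vE (bigD1 (Ordinal iN)) //= big1 ?addr0 // => j ji.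
  by rewrite projE ?linear0.
have -> : v = 0.
  rewrite vE big1 // => j _; rewrite projE ?linear0 //.
  by rewrite neq_ltn (leq_trans (ltn_ord j) Ni).
by rewrite !linear0.
Qed.

Lemma inj_bracket a b : inj 1 (bracket a b) = nprod (inj 1 a) 0 (inj 1 b).
Proof.
suff [u uE] : homogeneous 1 (nprod (inj 1 a) 0 (inj 1 b)).
  by rewrite /bracket uE projK.
apply: L0_homogeneous; rewrite scale1r.
have [N0 /(_ (N0 + 2)%N (leq_addr _ _))] :=
  borcherds (omega : V) (inj 1 a) (inj 1 b) 0 1 0.
rewrite addn2 !big_ord_recl !big1 /=; last 2 first.
- move=> i _; rewrite /binz !big_ord_recl /= subrr mul0r mulr0z mul0r mulr0.
  by rewrite scale0r.
- move=> i _; rewrite /binz !big_ord_recl /= /bump /= !add1n.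
  by rewrite subrr mul0r mulr0 mulr0z mul0r scale0r.
rewrite /binz !big_ord0 !big_ord_recl !big_ord0 /= /bump /= !add1n.
rewrite !(subrr, sub0r, subr0, addr0, add0r, mulr1, mul0r, mulr0z, divr1,
  scale1r, expr0, mulr0, scale0r, expr0z, mul1r) /=.
rewrite translation L0_grading !L0_grading !scale1r scaleN1r /=.
by move/eqP; rewrite addrC subrr eq_sym subr_eq0 => /eqP.
Qed.

Definition ad (a : V1) : 'End(V1) := linfun (bracket a).

End Notions.

Definition trace (K : fieldType) (E : vectType K) (f : 'End(E)) : K :=
  \tr (passmx.mxof (vbasis {: E}) (vbasis {: E}) f).

(* Main.v *)
Require Import Defs.
From mathcomp Require Import all_boot all_order all_algebra.
From mathcomp Require Import reals complex.
From HB Require Import structures.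
From mathcomp Require Import ring zify.

(** Write k for the second Casimir element, d for dim V^1 and s for the scalar
    with k = s omega, which exists because omega spans V_omega^2
    ([Vomega2]).  Two products with k are computed once from its
    definition and once from k = s omega.

    Applying L(2) = omega_(3) gives d 1 from the definition, since
    [L(2), x_(-1)] = x_(1) and x_(1) y = (x|y) 1 on V^1, and s (c/2) 1 from
    k = s omega; hence s = 2 d / c.

    Applying a_(1) for a in V^1 and moving it past x^j_(-1) produces
    a_(1) k = 2 a + sum_j [[a, x^j], x_j].  Paired with b, the double brackets
    sum up to the Killing form, so (b | a_(1) k) = 2 (a|b) + Tr (ad b) (ad a)
    ([casimir2_act]).  Since a_(1) omega = a, this equals s (a|b), and the
    Killing form is therefore 2 (d/c - 1) (.|.).

    It remains to express the trace of three factors by that of two.  The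
    operators ad a are skew for the form, so transposition gives
    Tr a1 a2 a3 = - Tr a3 a2 a1 = - Tr a1 a3 a2, and
    2 Tr a1 a2 a3 = Tr a1 [a2, a3] ([trace_ad3]) is a value of the Killing form.

    All of this rests on two consequences of invariance: L(1) kills V^1
    ([L1_V1]), which makes a_(-n) the adjoint of - a_(n), and
    a_(1) b = (a|b) 1 ([V1_prod1]), where (1|1) = -1 enters. *)

Set Implicit Arguments.
Unset Strict Implicit.
Unset Printing Implicit Defensive.

Import Order.TTheory GRing.Theory Num.Theory.
Local Open Scope ring_scope.

(** * Products and the grading *)

Section Products.
Variables (K : numFieldType) (V : voa K).
Implicit Types (a b u v : V) (m n : int).

HB.instance Definition _ a n :=
  GRing.isLinear.Build K V V *:%R (nprod a n) (nprod_linearr a n).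

(** Names the product as a function of its left factor, so that this function
    can carry a linear structure. *)
Definition rprod n b a : V := nprod a n b.

HB.instance Definition _ n b :=
  GRing.isLinear.Build K V V *:%R (rprod n b) (nprod_linearl n b).

Lemma nprod0l n b : nprod (0 : V) n b = 0.
Proof. exact: (linear0 (rprod n b)). Qed.

Lemma nprodZl k a n b : nprod (k *: a) n b = k *: nprod a n b.
Proof. exact: (linearZ_LR (rprod n b)). Qed.

Lemma binz0n i : binz K 0 i.+1 = 0.
Proof. by rewrite /binz big_ord_recl subrr mul0r mul0r. Qed.

Lemma binzn0 m : binz K m 0 = 1.
Proof. by rewrite /binz big_ord0 divr1. Qed.

Lemma binzn1 m : binz K m 1 = m%:~R.
Proof. by rewrite /binz big_ord1 subr0 divr1. Qed.

(** The Jacobi identity at l = 0, where only the term i = 0 survives on the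
    right.  The bound k lets the sum stop as soon as either factor of each
    further term vanishes: the binomial coefficient (when 0 <= m < k), or the
    product (for degree reasons). *)
Lemma commutator a b u m n k :
  (forall i : nat, (k <= i)%N -> binz K m i = 0 \/ nprod a i%:Z b = 0) ->
  nprod a m (nprod b n u) - nprod b n (nprod a m u) =
  \sum_(i < k) binz K m i *: nprod (nprod a i%:Z b) (m + n - i%:Z) u.
Proof.
move=> small; have [N0 jac] := borcherds a b u 0 m n.
have := jac (N0 + k).+1 (leqW (leq_addr _ _)).
rewrite [RHS]big_ord_recl [X in _ = _ + X]big1 => [|i _]; last first.
  by rewrite binz0n mulr0 scale0r.
rewrite binzn0 expr0 !(mul1r, scale1r, add0r, addr0, subr0) => <-.
rewrite -(big_mkord xpredT
  (fun i : nat => binz K m i *: nprod (nprod a (0 + i%:Z) b) (m + n - i%:Z) u)).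
rewrite (big_cat_nat (n := k)) ?leq_addl //=; last by rewrite leqW ?leq_addl.
rewrite big_mkord [X in _ + X]big_nat [X in _ + X]big1 ?addr0.
  by apply: eq_bigr => i _; rewrite add0r.
move=> i /andP[/small[->|]]; first by rewrite scale0r.
by rewrite add0r => ->; rewrite nprod0l scaler0.
Qed.

(** The Jacobi identity at m = 0: products by a_(l) b are combinations of
    composites of products by a and by b. *)
Lemma iterate_formula a b u (l n : int) : exists N : nat,
  nprod (nprod a l b) n u =
  \sum_(i < N) ((-1) ^+ i * binz K l i) *:
    (nprod a (l - i%:Z) (nprod b (n + i%:Z) u) -
     (-1) ^ l *: nprod b (l + n - i%:Z) (nprod a i%:Z u)).
Proof.
have [N0 /(_ N0.+1 (leqnSn _))] := borcherds a b u l 0 n.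
rewrite big_ord_recl [X in _ + X = _]big1 => [|i _]; last first.
  by rewrite binz0n scale0r.
rewrite binzn0 scale1r !(addr0, add0r, subr0) => ->; exists N0.+1.
by apply: eq_bigr => i _; rewrite !add0r.
Qed.

Lemma proj_L0 i v : proj i (nprod omega 1 v) = i%:R *: proj i v.
Proof.
have [N {1 2}->] := proj_sum v; rewrite !linear_sum.
apply: eq_bigr => j _; rewrite /= L0_grading linearZ /=.
have [->|ij] := eqVneq i j; first by [].
by rewrite proj_neq // !scaler0.
Qed.

Lemma proj_eq0 v : (forall i, proj i v = 0) -> v = 0.
Proof.
by move=> v0; have [N ->] := proj_sum v; rewrite big1 // => i _; rewrite v0 linear0.
Qed.

(** L(0) acts on V^i as i, so its eigenvalues are natural numbers. *)
Lemma L0_eigen_eq0 v n : n < 0 -> nprod omega 1 v = n%:~R *: v -> v = 0.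
Proof.
move=> n_lt0 L0v; apply: proj_eq0 => i; apply/eqP.
have /eqP := congr1 (proj i) L0v.
rewrite proj_L0 linearZ /= -subr_eq0 -scalerBl scaler_eq0 => /orP[|//].
by rewrite -(mulrz_nat i) -rmorphB intr_eq0 => /eqP; lia.
Qed.

Lemma homogeneous_L0 i v : homogeneous i v -> nprod omega 1 v = i%:R *: v.
Proof. by case=> u ->; rewrite L0_grading. Qed.

Lemma homogeneous_inj i (u : piece V i) : homogeneous i (inj i u).
Proof. by exists u. Qed.

Lemma binz1_gt1 i : (2 <= i)%N -> binz K 1 i = 0.
Proof.
by case: i => [|[|i]] // _; rewrite /binz !big_ord_recl subrr mul0r mulr0 mul0r.
Qed.

(** From [L(0), a_(n)] = (L(-1) a)_(n+1) + (L(0) a)_(n), where the first term is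
    - (n + 1) a_(n). *)
Lemma L0_nprod p q a b n : homogeneous p a -> homogeneous q b ->
  nprod omega 1 (nprod a n b) = (p%:Z + q%:Z - n - 1)%:~R *: nprod a n b.
Proof.
move=> ap bq.
have := @commutator omega a b 1 n 2 (fun i i2 => or_introl (binz1_gt1 i2)).
rewrite !big_ord_recl big_ord0 binzn0 binzn1 /= translation.
rewrite (homogeneous_L0 ap) (homogeneous_L0 bq) linearZ nprodZl /= addr0 !scale1r.
rewrite /bump /= addr0 (addrAC 1) subrr add0r.
move/eqP; rewrite subr_eq => /eqP ->; rewrite -!scalerDl; congr (_ *: _).
by ring.
Qed.

Lemma nprod_neg_degree p q a b n : homogeneous p a -> homogeneous q b ->
  p%:Z + q%:Z - n - 1 < 0 -> nprod a n b = 0.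
Proof. by move=> ap bq /L0_eigen_eq0; apply; exact: L0_nprod. Qed.

Lemma nprod_homogeneous p q r a b n : homogeneous p a -> homogeneous q b ->
  p%:Z + q%:Z - n - 1 = r%:Z -> homogeneous r (nprod a n b).
Proof. by move=> ap bq rE; apply: L0_homogeneous; rewrite (L0_nprod _ ap bq) rE. Qed.

Lemma homogeneous_omega : homogeneous 2 (omega : V).
Proof. exact: omega_piece. Qed.

Lemma homogeneous_vac : homogeneous 0 (vac : V).
Proof. exact: vac_piece. Qed.

(** * The degree two part of the subVOA generated by omega *)

Lemma omegaE : nprod omega (-1) vac = (omega : V).
Proof. exact: creation. Qed.

(** The span of the monomials L(n1) ... L(nk) 1 with all ni < 0; L(m) being
    omega_(m+1), the creation operators are the omega_(n) with n <= 0. *)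
Inductive vir_span : V -> Prop :=
| VirVac : vir_span vac
| VirLin k u v : vir_span u -> vir_span v -> vir_span (k *: u + v)
| VirAct n v : n <= 0 -> vir_span v -> vir_span (nprod omega n v).

Lemma vir_span0 : vir_span 0.
Proof. by rewrite -(addNr vac) -scaleN1r; apply: VirLin; exact: VirVac. Qed.

Lemma vir_spanZ k v : vir_span v -> vir_span (k *: v).
Proof. by move=> v_in; rewrite -[_ *: _]addr0; exact: VirLin v_in vir_span0. Qed.

Lemma vir_spanD u v : vir_span u -> vir_span v -> vir_span (u + v).
Proof. by move=> u_in v_in; rewrite -[u]scale1r; exact: VirLin. Qed.

(** An annihilation operator is moved to the right past the creation operators
    by the Virasoro relations, until it reaches the vacuum, which it kills. *)
Lemma vir_span_omega n v : vir_span v -> vir_span (nprod omega n v).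
Proof.
move=> v_in; elim: v_in n => [|k u {}v _ IHu _ IHv|m {}v m_le0 v_in IHv] n.
- have [n_ge0|n_lt0] := leP 0 n.
    by rewrite creation_ge0 //; exact: vir_span0.
  by apply: VirAct; [exact: ltW | exact: VirVac].
- by rewrite nprod_linearr; apply: VirLin.
have [n_le0|_] := leP n 0; first by do 2?apply: VirAct.
have := virasoro (n - 1) (m - 1) v; rewrite !subrK => /eqP.
rewrite subr_eq => /eqP ->; apply: vir_spanD; last exact: VirAct.
by apply: vir_spanD; apply: vir_spanZ.
Qed.

(** Induction on the monomial u: by the iterate formula, products by omega_(m) u
    are built from products by omega and by u, both of which preserve the
    span. *)
Lemma vir_span_nprod u n v : vir_span u -> vir_span v -> vir_span (nprod u n v).
Proof.
move=> u_in; elim: u_in n v => [|k {}u u' _ IHu _ IHu'|m {}u _ _ IHu] n v v_in.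
- by rewrite vacuum; case: ifP => // _; exact: vir_span0.
- by rewrite nprod_linearl; apply: VirLin; [exact: IHu | exact: IHu'].
have [N ->] := iterate_formula omega u v m n.
elim/big_rec: _ => [|i w _ w_in]; first exact: vir_span0.
apply: VirLin => //; apply: vir_spanD; first exact/vir_span_omega/IHu.
by rewrite -scaleNr; apply/vir_spanZ/IHu/vir_span_omega.
Qed.

Lemma Vomega_vir_span v : Vomega v -> vir_span v.
Proof.
apply; last by rewrite -omegaE; exact: VirAct VirVac.
by split; [exact: VirVac | exact: VirLin | exact: vir_span_nprod].
Qed.

Definition degree_ge3 v := forall i, (i < 3)%N -> proj i v = 0.

Lemma degree_ge3_lin k u v :
  degree_ge3 u -> degree_ge3 v -> degree_ge3 (k *: u + v).
Proof. by move=> u3 v3 i i3; rewrite linearP u3 // v3 // scaler0 addr0. Qed.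

Lemma degree_ge3_0 : degree_ge3 0.
Proof. by move=> i _; rewrite linear0. Qed.

Lemma nprod_degree_ge3 p q a b n : homogeneous p a -> homogeneous q b ->
  3 <= p%:Z + q%:Z - n - 1 -> degree_ge3 (nprod a n b).
Proof.
move=> ap bq r_ge3 i i3.
have [|u ->] := @nprod_homogeneous p q (absz (p%:Z + q%:Z - n - 1)%R) a b n ap bq.
  by lia.
by rewrite proj_neq //; lia.
Qed.

Lemma omega_degree_ge3 n v : n <= 0 -> degree_ge3 v ->
  degree_ge3 (nprod omega n v).
Proof.
move=> n_le0 v3; have [N ->] := proj_sum v; rewrite linear_sum /=.
elim/big_rec: _ => [|i w _ w3]; first exact: degree_ge3_0.
rewrite -[X in degree_ge3 (X + _)]scale1r; apply: degree_ge3_lin => //.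
have [i3|i3] := ltnP i 3; first by rewrite v3 // !linear0; exact: degree_ge3_0.
by apply: (nprod_degree_ge3 homogeneous_omega (homogeneous_inj _)); lia.
Qed.

(** Creation operators raise the degree, so that in degrees at most 2 they
    produce only L(-1) 1 = 0 and L(-2) 1 = omega. *)
Lemma vir_span_low v : vir_span v ->
  exists k l, exists2 w, degree_ge3 w & v = k *: vac + (l *: omega + w).
Proof.
elim=> [|k {}v v' _ [k1 [l1 [w1 w1_3 ->]]] _ [k2 [l2 [w2 w2_3 ->]]]|n {}v n_le0 _].
- by exists 1, 0, 0; [exact: degree_ge3_0 | rewrite scale1r scale0r !addr0].
- exists (k * k1 + k2), (k * l1 + l2), (k *: w1 + w2).
    exact: degree_ge3_lin.
  by rewrite !scalerDr !scalerDl !scalerA addrACA [X in _ + X = _]addrACA.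
case=> k [l [w w3 ->]]; rewrite !linearP /=.
have omega3 : degree_ge3 (nprod omega n (omega : V)).
  by apply: (nprod_degree_ge3 homogeneous_omega homogeneous_omega); lia.
have rest3 := degree_ge3_lin l omega3 (omega_degree_ge3 n_le0 w3).
have [n0|n_neq0] := eqVneq n 0.
  exists 0, 0; exists (l *: nprod omega n omega + nprod omega n w) => //.
  by rewrite n0 creation_ge0 // scaler0 !scale0r !add0r.
have [n1|n_neq1] := eqVneq n (-1).
  exists 0, k; exists (l *: nprod omega n omega + nprod omega n w) => //.
  by rewrite n1 omegaE scale0r add0r.
exists 0, 0; eexists; last by rewrite !scale0r !add0r.
apply: degree_ge3_lin => //.
apply: (nprod_degree_ge3 homogeneous_omega homogeneous_vac).
by move: n_le0 n_neq0 n_neq1 {omega3 rest3}; lia.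
Qed.

Lemma Vomega2 v : Vomega_piece 2 v -> exists s, v = s *: omega.
Proof.
case=> /Vomega_vir_span/vir_span_low [k [l [w w3 vE]]] [u uE]; exists l.
have -> : v = inj 2 (proj 2 v) by rewrite uE projK.
rewrite vE !linearD !linearZ /= w3 // linear0 addr0.
have [o ->] := @homogeneous_omega; have [t ->] := @homogeneous_vac.
by rewrite projK proj_neq // linear0 scaler0 add0r.
Qed.

End Products.

Arguments homogeneous_omega {K} V.
Arguments homogeneous_vac {K} V.

(** * Traces *)

Section Trace.
Variables (F : fieldType) (E : vectType F).
Implicit Types f g : 'End(E).

Lemma traceE f :
  trace f = \sum_(i < \dim {: E}) coord (vbasis {: E}) i (f (vbasis {: E})`_i).
Proof.
rewrite /trace /mxtrace; apply: eq_bigr => i _.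
by rewrite /passmx.mxof !mxE /= passmx.vecof_delta.
Qed.

Lemma traceB f g : trace (f - g) = trace f - trace g.
Proof.
rewrite !traceE -sumrB; apply: eq_bigr => i _.
by rewrite add_lfunE opp_lfunE linearB.
Qed.

Lemma trace_compC f g : trace (f \o g)%VF = trace (g \o f)%VF.
Proof.
rewrite /trace !(passmx.mxof_comp _ _ (vbasisP {: E})).
exact: mxtrace_mulC.
Qed.

(** The functionals c_j are coordinates only in the weak sense that they rebuild
    every vector; this is the form in which a dual basis provides them. *)
Lemma trace_expansion n (x : n.-tuple E) (c : 'I_n -> E -> F) f :
  (forall j, scalar (c j)) ->
  (forall v, v = \sum_j c j v *: tnth x j) ->
  trace f = \sum_j c j (f (tnth x j)).
Proof.
move=> c_lin vE; pose e := vbasis {: E}.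
have c_sum j m (k : 'I_m -> F) (w : 'I_m -> E) :
    c j (\sum_i k i *: w i) = \sum_i k i * c j (w i).
  elim: m k w => [|m IHm] k w; last first.
    by rewrite !big_ord_recl c_lin IHm.
  rewrite !big_ord0; have := c_lin j (-1) 0 0.
  by rewrite scaler0 addr0 mulN1r addNr.
rewrite traceE -/e.
(* Expanding each f e_i along the x_j, then summing over i first, reassembles
   x_j from its coordinates on e inside c_j (f _). *)
under eq_bigr => i _ do rewrite [f e`_i]vE linear_sum /=.
rewrite exchange_big; apply: eq_bigr => j _ /=.
rewrite [in RHS](coord_basis (vbasisP {: E}) (memvf (tnth x j))) linear_sum /=.
under [in RHS]eq_bigr => i _ do rewrite linearZ /=.
by rewrite c_sum; apply: eq_bigr => i _; rewrite linearZ /= mulrC.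
Qed.

End Trace.

(** * The invariant form on V^1 *)

Section Form.
Variables (K : numFieldType) (V : voa K) (B : V -> V -> K).
Hypotheses (Vcft : cft_type V) (Binv : invariant_bilinear_form B).
Hypothesis Bvac : B vac vac = -1.
Implicit Types (a b u v : V) (m n : int).

Let B_linr u : scalar (B u). Proof. by case: Binv. Qed.
Let B_linl v : scalar (B^~ v). Proof. by case: Binv. Qed.
Let B_inv : Defs.invariant B. Proof. by case: Binv. Qed.

HB.instance Definition _ u := GRing.isLinear.Build K V K *%R (B u) (B_linr u).

Let Bl v u := B u v.
HB.instance Definition _ v := GRing.isLinear.Build K V K *%R (Bl v) (B_linl v).

Let formZl k u v : B (k *: u) v = k * B u v.
Proof. exact: (linearZ_LR (Bl v)). Qed.

Lemma L1_omega : nprod omega 2 omega = 0 :> V.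
Proof.
have := virasoro 1 (-2) (vac : V).
rewrite omegaE /= !creation_ge0 // linear0 scaler0 subr0 scale0r addr0.
exact.
Qed.

(** L(1) a lies in V^0 = K 1, and L(1) is adjoint to L(-1), which kills 1: hence
    (L(1) a | 1) = (a | L(-1) 1) = 0. *)
Lemma L1_V1 a : homogeneous 1 a -> nprod omega 2 a = 0.
Proof.
move=> a1; have /Vcft[k L1a] : homogeneous 0 (nprod omega 2 a).
  exact: (nprod_homogeneous (homogeneous_omega V) a1).
have := B_inv 2 a vac (homogeneous_omega V).
rewrite !big_ord_recl big_ord0 /= /Lop L1_omega linear0 !nprod0l !linear0.
rewrite creation_ge0 // linear0 !mulr0 !addr0 mulr0 L1a.
rewrite formZl Bvac => /eqP.
by rewrite mulrN1 oppr_eq0 => /eqP ->; rewrite scale0r.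
Qed.

(** In the invariance formula for a in V^1 the correction term involves
    L(1) a = 0. *)
Lemma V1_adjoint a n u v : homogeneous 1 a ->
  B (nprod a n u) v = - B u (nprod a (- n) v).
Proof.
move=> a1; rewrite (B_inv _ _ _ a1) !big_ord_recl big_ord0 /= /Lop L1_V1 //.
rewrite nprod0l linear0 mulr0 !addr0 expr1 invr1 mul1r mulN1r.
by congr (- B u (nprod a _ v)); ring.
Qed.

(** The coefficient is found by writing a = a_(-1) 1 and moving a_(-1) to the
    other side of the form. *)
Lemma V1_prod1 a b : homogeneous 1 a -> homogeneous 1 b ->
  nprod a 1 b = B a b *: vac.
Proof.
move=> a1 b1; have /Vcft[k abE] : homogeneous 0 (nprod a 1 b).
  exact: (nprod_homogeneous a1 b1).
by rewrite -{2}[a]creation V1_adjoint // opprK abE linearZ /= Bvac mulrN1 opprK.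
Qed.

(** The affine Lie algebra relations: a_(i) b has negative degree for i > 1. *)
Lemma V1_commutator a b m n u : homogeneous 1 a -> homogeneous 1 b ->
  nprod a m (nprod b n u) - nprod b n (nprod a m u) =
  nprod (nprod a 0 b) (m + n) u +
  (if m + n == 0 then m%:~R * B a b else 0) *: u.
Proof.
move=> a1 b1; rewrite (@commutator _ _ a b u m n 2) => [|i i2]; last first.
  by right; apply: (nprod_neg_degree a1 b1); lia.
rewrite !big_ord_recl big_ord0 binzn0 binzn1 /= scale1r !addr0 V1_prod1 //.
rewrite nprodZl vacuum -{2}[-1]add0r (inj_eq (addIr _)).
by case: ifP => _; rewrite ?scaler0 ?scale0r // scalerA.
Qed.

(** Elements of V^1 are primary: omega_(2) a = L(1) a vanishes, and omega_(i) a
    has negative degree for i > 2. *)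
Lemma omega_V1_commutator a m n u : homogeneous 1 a ->
  nprod omega m (nprod a n u) - nprod a n (nprod omega m u) =
  (- n)%:~R *: nprod a (m + n - 1) u.
Proof.
move=> a1; rewrite (@commutator _ _ omega a u m n 2) => [|i i2]; last first.
  right; have [<-|i_neq2] := eqVneq 2%N i; first exact: L1_V1.
  by apply: (nprod_neg_degree (homogeneous_omega V) a1); lia.
rewrite !big_ord_recl big_ord0 binzn0 binzn1 /= scale1r !addr0.
rewrite translation (homogeneous_L0 a1) scale1r -scalerDl; congr (_ *: _).
by ring.
Qed.

(** Comparison of both sides of [b_(-1), a_(0)] on the vacuum. *)
Lemma V1_prod0_skew a b : homogeneous 1 a -> homogeneous 1 b ->
  nprod b 0 a = - nprod a 0 b.
Proof.
move=> a1 b1; have := V1_commutator (-1) 0 vac b1 a1.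
rewrite addr0 /= scale0r addr0 !creation => <-.
by rewrite creation_ge0 // linear0 sub0r.
Qed.

(** Applied to the vacuum, [b_(-1), a_(1)] gives - a_(1) b = - (a|b) 1, while the
    affine relations leave only the central term - (b|a) 1. *)
Lemma V1_form_sym a b : homogeneous 1 a -> homogeneous 1 b -> B a b = B b a.
Proof.
move=> a1 b1; have := V1_commutator (-1) 1 vac b1 a1.
rewrite addNr eqxx creation !creation_ge0 // linear0 sub0r add0r.
rewrite V1_prod1 // mulN1r scaleNr.
move/oppr_inj/(congr1 (B vac)); rewrite !linearZ /= Bvac !mulrN1.
exact: oppr_inj.
Qed.

(** L(2) L(-2) 1 = [L(2), L(-2)] 1 = 4 L(0) 1 + (c/2) 1. *)
Lemma omega3_omega : nprod omega 3 omega = (ccharge V / 2) *: vac :> V.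
Proof.
have := virasoro 2 (-2) (vac : V).
rewrite omegaE !creation_ge0 // linear0 scaler0 subr0 add0r eqxx => ->.
by congr (_ *: _); field.
Qed.

Lemma V1_omega a : homogeneous 1 a -> nprod a 1 omega = a.
Proof.
move=> a1; have := omega_V1_commutator (-1) 1 vac a1.
rewrite omegaE creation_ge0 // linear0 sub0r creation scaleN1r.
exact: oppr_inj.
Qed.

Local Notation j := (inj 1).
Local Notation inj1 := (homogeneous_inj _).
Implicit Types (p q r : V1 V) (x y : (dimV1 V).-tuple (V1 V)).

Let inj1_inj : injective (j : V1 V -> V).
Proof. by apply: (can_inj (g := proj 1)) => u; rewrite projK. Qed.

Lemma inj1_form_sym p q : B (j p) (j q) = B (j q) (j p).
Proof. exact: V1_form_sym inj1 inj1. Qed.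

(** Pairing a linear relation between the y_j with x_i isolates its i-th
    coefficient, so y is free, and its size makes it a basis. *)
Lemma dual_bases_sym x y : dual_bases B x y -> dual_bases B y x.
Proof.
case=> x_basis xy; split; last by move=> i k; rewrite inj1_form_sym xy eq_sym.
rewrite basisEfree subvf size_tuple leqnn /= andbT.
apply/freeP => k k0 i; have /(congr1 (B (j (tnth x i)))) := congr1 j k0.
rewrite !linear_sum !linear0 (bigD1 i) //= big1 => [|l li].
  by rewrite addr0 !linearZ /= -tnth_nth xy eqxx mulr1.
by rewrite !linearZ /= -tnth_nth xy eq_sym (negPf li) mulr0.
Qed.

Lemma dual_expansion x y p : dual_bases B x y ->
  p = \sum_i B (j (tnth y i)) (j p) *: tnth x i.
Proof.
case=> x_basis xy; rewrite {1}(coord_basis x_basis (memvf p)).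
apply: eq_bigr => i _; rewrite -tnth_nth; congr (_ *: _).
rewrite [p in RHS](coord_basis x_basis (memvf p)) !linear_sum (bigD1 i) //=.
rewrite -tnth_nth !linearZ /= inj1_form_sym xy eqxx mulr1 big1 ?addr0 // => l li.
by rewrite -tnth_nth !linearZ /= inj1_form_sym xy (negPf li) mulr0.
Qed.

Lemma trace_dual x y (f : 'End(V1 V)) : dual_bases B x y ->
  trace f = \sum_i B (j (tnth y i)) (j (f (tnth x i))).
Proof.
move=> xy; pose c i (u : V1 V) := B (j (tnth y i)) (j u).
apply: (@trace_expansion _ _ _ x c) => [i k u v|v]; last exact: dual_expansion.
by rewrite /c !linearP.
Qed.

Lemma ad_skew p q r : B (j (ad p q)) (j r) = - B (j q) (j (ad p r)).
Proof. by rewrite !lfunE /= !inj_bracket V1_adjoint ?oppr0 //; exact: inj1. Qed.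

Lemma ad_swap p q : ad p q = - ad q p.
Proof.
apply: inj1_inj; rewrite linearN !lfunE /= !inj_bracket.
by apply: V1_prod0_skew; exact: homogeneous_inj.
Qed.

Lemma ad_bracket p q : (ad p \o ad q)%VF - (ad q \o ad p)%VF = ad (ad p q).
Proof.
apply/lfunP => r; rewrite add_lfunE opp_lfunE !comp_lfunE.
apply: inj1_inj; rewrite linearB !lfunE /= !inj_bracket.
rewrite (V1_commutator 0 0 (j r) inj1 inj1).
by rewrite addr0 eqxx mul0r scale0r addr0.
Qed.

(** Transposition, ad a being skew: the transpose is computed in the dual
    basis. *)
Lemma trace_ad3_rev x y p q r : dual_bases B x y ->
  trace (ad p \o ad q \o ad r)%VF = - trace (ad r \o ad q \o ad p)%VF.
Proof.
move=> xy; rewrite (trace_dual _ xy) (trace_dual _ (dual_bases_sym xy)) -sumrN.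
by apply: eq_bigr => i _; rewrite !comp_lfunE inj1_form_sym !ad_skew opprK.
Qed.

(** By reversal and cyclicity, Tr p q r = - Tr r q p = - Tr p r q. *)
Lemma trace_ad3 x y p q r : dual_bases B x y ->
  trace (ad p \o ad q \o ad r)%VF *+ 2 = trace (ad p \o ad (ad q r))%VF.
Proof.
move=> xy; rewrite -ad_bracket mulr2n {2}(trace_ad3_rev _ _ _ xy).
rewrite [X in _ - X]trace_compC -traceB; congr trace; apply/lfunP => u.
by rewrite !(add_lfunE, opp_lfunE, comp_lfunE) linearB.
Qed.

(** * The Casimir element and the Killing form *)

(** For p = [a, x_i] and r the dual vector of x_i, this turns a double bracket
    paired with q into a diagonal entry of ad q ad a. *)
Lemma form_prod0_ad p q r : B (j q) (nprod (j p) 0 (j r)) = B (j r) (j (ad q p)).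
Proof.
have -> : nprod (j p) 0 (j r) = j (ad p r) by rewrite lfunE /= inj_bracket.
rewrite [RHS]inj1_form_sym ad_skew (ad_swap p) (ad_swap q) !linearN /=.
by rewrite inj1_form_sym ad_skew.
Qed.

(** Moving p_(1) past x_(-1) to the right in p_(1) x_(-1) y leaves three terms:
    (p|y) x and (p|x) y, each of which adds up to p over the dual bases, and
    [[p, x], y]. *)
Lemma casimir2_act x y p q : dual_bases B x y ->
  B (j q) (nprod (j p) 1 (casimir x y 2)) =
  B (j q) (j p) *+ 2 + trace (ad q \o ad p)%VF.
Proof.
move=> xy; rewrite (trace_dual _ xy) /casimir !linear_sum /=.
have form_dual r s :
    B (j r) (j s) = \sum_i B (j (tnth y i)) (j s) * B (j r) (j (tnth x i)).
  rewrite {1}(dual_expansion s xy) !linear_sum /=.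
  by apply: eq_bigr => i _; rewrite !linearZ.
(* One copy of (q|p) is expanded as it stands and the other one after exchanging
   p and q, which yields the two kinds of terms. *)
rewrite mulr2n {2}inj1_form_sym !form_dual -!big_split; apply: eq_bigr => i _ /=.
have := V1_commutator 1 (-1) (j (tnth y i)) (homogeneous_inj p)
  (homogeneous_inj (tnth x i)).
move/eqP; rewrite subr_eq => /eqP ->; rewrite subrr eqxx mul1r !linearD /=.
rewrite V1_prod1; try exact: inj1.
rewrite !linearZ /= creation -inj_bracket form_prod0_ad addrC addrA.
rewrite comp_lfunE [ad p _]lfunE /= (inj1_form_sym (tnth y i) p).
by rewrite (inj1_form_sym (tnth y i) q) addrAC (mulrC (B (j p) (j (tnth x i)))).
Qed.

(** [L(2), x_(-1)] = x_(1) and L(2) y = 0, so each of the d summands contributes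
    (x^j|x_j) 1 = 1. *)
Lemma omega3_casimir2 x y : dual_bases B x y ->
  nprod omega 3 (casimir x y 2) = (dimV1 V)%:R *: vac.
Proof.
case=> _ xy; rewrite /casimir linear_sum /=.
rewrite (eq_bigr (fun=> vac)) => [|i _].
  by rewrite sumr_const card_ord scaler_nat.
have := omega_V1_commutator 3 (-1) (j (tnth y i)) (homogeneous_inj (tnth x i)).
rewrite (nprod_neg_degree (homogeneous_omega V) (homogeneous_inj (tnth y i))) //.
by rewrite linear0 subr0 scale1r V1_prod1 ?xy ?eqxx ?scale1r //; exact: inj1.
Qed.

Lemma trace_ad3_form x y p q r : ccharge V != 0 -> dual_bases B x y ->
  Vomega_piece 2 (casimir x y 2) ->
  trace (ad p \o ad q \o ad r)%VF =
  ((dimV1 V)%:R / ccharge V - 1) * B (j p) (nprod (j q) 0 (j r)).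
Proof.
move=> c_neq0 xy /Vomega2[s kappaE].
have sE : s = (dimV1 V)%:R / ccharge V * 2.
  have := omega3_casimir2 xy; rewrite kappaE linearZ /= omega3_omega scalerA.
  move=> /(congr1 (B vac)); rewrite !linearZ /= Bvac !mulrN1 => /oppr_inj <-.
  by field.
have killing (t t' : V1 V) : trace (ad t \o ad t')%VF = (s - 2) * B (j t) (j t').
  have := casimir2_act t' t xy; rewrite kappaE linearZ /= V1_omega; last exact: inj1.
  by rewrite linearZ /= => sB; rewrite mulrBl sB; ring.
have := trace_ad3 p q r xy; rewrite killing lfunE /= inj_bracket sE => trE.
apply: (mulIf (x := 2)); first by rewrite pnatr_eq0.
by rewrite mulr_natr trE; ring.
Qed.

End Form.

Theorem proposition3p4 (R : realType) (V : voa R[i]) (B : V -> V -> R[i])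
  (Vcft : cft_type V)
  (Binv : invariant_bilinear_form B) (Bnondeg : nondegenerate_form B)
  (Bvac : B vac vac = -1)
  (dimV1_gt0 : (0 < dimV1 V)%N)
  (c_neq0 : ccharge V != 0)
  (x y : (dimV1 V).-tuple (V1 V)) (xy_dual : dual_bases B x y)
  (kappa2 : Vomega_piece 2 (casimir x y 2)) :
  forall a1 a2 a3 : V1 V,
    trace (ad a1 \o ad a2 \o ad a3)%VF =
    ((dimV1 V)%:R / ccharge V - 1) *
      B (inj 1 a1) (nprod (inj 1 a2) 0 (inj 1 a3)).
Proof. by move=> a1 a2 a3; exact: (@trace_ad3_form _ _ _ Vcft Binv Bvac x y). Qed.
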